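(* Let $\mathbb{F}$ be an algebraically closed field, let $n\ge 3$ and $k\ge 2$ be integers, and let $$\mathfrak{p}(x_1,\dots,x_k)=\sum_{\sigma\in\mathcal{S}_k}\alpha_\sigma\, x_{\sigma(1)}\cdots x_{\sigma(k)}\qquad(\alpha_\sigma\in\mathbb{F})$$ be a homogeneous multilinear polynomial in noncommuting variables with $\sum_{\sigma\in\mathcal{S}_k}\alpha_\sigma\ne 0$, such that the matrix $\mathrm{Cof}(\mathfrak{p})\in\mathcal{M}_k(\mathbb{F})$ whose $(i,j)$ entry is $\sum_{\sigma\in\mathcal{S}_k,\ \sigma(i)=j}\alpha_\sigma$ is invertible. Let $\mathfrak{D}_1,\mathfrak{D}_2\subseteq\mathcal{M}_n(\mathbb{F})$ be subsets each of which contains all matrices of rank one and all idempotents of rank $n-1$. If a (possibly nonsurjective) map $\Phi:\mathfrak{D}_1\to\mathfrak{D}_2$ strongly preserves the zeros of $\mathfrak{p}$, then there exist a (possibly nonsurjective) field homomorphism $\varphi:\mathbb{F}\to\mathbb{F}$, a function $\gamma:\mathfrak{D}_1\setminus\{0\}\to\mathbb{F}\setminus\{0\}$, and an invertible matrix $T\in\mathcal{M}_n(\mathbb{F})$ such that (i) $\Phi(A)=\gamma(A)\,T A^{\varphi}T^{-1}$ for all rank-one matrices $A$, or (ii) $\Phi(A)=\gamma(A)\,T (A^{\varphi})^{\mathrm{tr}}T^{-1}$ for all rank-one matrices $A$.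
   Context: $\mathcal{M}_n(\mathbb{F})$ is the algebra of $n\times n$ matrices over $\mathbb{F}$; $\mathcal{S}_k$ is the set of all permutations of $\{1,\dots,k\}$. For matrices, $\mathfrak{p}(A_1,\dots,A_k)=\sum_{\sigma}\alpha_\sigma A_{\sigma(1)}\cdots A_{\sigma(k)}$. A map $\Phi:\mathfrak{D}_1\to\mathfrak{D}_2$ strongly preserves the zeros of $\mathfrak{p}$ if for all $A_1,\dots,A_k\in\mathfrak{D}_1$: $\mathfrak{p}(A_1,\dots,A_k)=0\Longleftrightarrow\mathfrak{p}(\Phi(A_1),\dots,\Phi(A_k))=0$. No linearity or additivity of $\Phi$ is assumed. A field homomorphism is an additive and multiplicative function $\mathbb{F}\to\mathbb{F}$. $A^\varphi$ is the matrix obtained from $A$ by applying $\varphi$ entrywise, and $A^{\mathrm{tr}}$ is the transpose of $A$. *)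

(* Defs.v *)
From HB Require Import structures.
From mathcomp Require Import all_boot all_order all_algebra all_fingroup.

Set Implicit Arguments.
Unset Strict Implicit.
Unset Printing Implicit Defensive.

Import GRing.Theory.
Local Open Scope ring_scope.

(* A homogeneous multilinear polynomial of degree k in noncommuting variables,
   \sum_s alpha_s x_(s 1) ... x_(s k), is given by its coefficients
   alpha : 'S_k -> F; the variables and positions are numbered from 0. *)

Definition mlpoly_eval (F : fieldType) (n k : nat) (alpha : 'S_k -> F)
    (A : 'I_k -> 'M[F]_n) : 'M[F]_n :=
  \sum_(s : 'S_k) alpha s *: \prod_(i < k) A (s i).

Definition Cof (F : fieldType) (k : nat) (alpha : 'S_k -> F) : 'M[F]_k :=
  \matrix_(i, j) \sum_(s : 'S_k | s i == j) alpha s.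

(* A map D1 -> D2 is a function on all of 'M[F]_n of which only the values on
   D1 are constrained. *)
Definition maps_into (T U : Type) (D1 : T -> Prop) (D2 : U -> Prop)
    (Phi : T -> U) : Prop :=
  forall A, D1 A -> D2 (Phi A).

Definition strongly_preserves_zeros (F : fieldType) (n k : nat)
    (alpha : 'S_k -> F) (D1 : 'M[F]_n -> Prop) (Phi : 'M[F]_n -> 'M[F]_n)
    : Prop :=
  forall A : 'I_k -> 'M[F]_n, (forall i, D1 (A i)) ->
    (mlpoly_eval alpha A = 0 <-> mlpoly_eval alpha (fun i => Phi (A i)) = 0).

Definition contains_rank_one (F : fieldType) (n : nat)
    (D : 'M[F]_n -> Prop) : Prop :=
  forall A : 'M[F]_n, \rank A = 1%N -> D A.

Definition contains_corank_one_idempotents (F : fieldType) (n : nat)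
    (D : 'M[F]_n -> Prop) : Prop :=
  forall P : 'M[F]_n, P *m P = P -> \rank P = n.-1 -> D P.

(* Main.v *)
Require Import Defs.
From HB Require Import structures.
From mathcomp Require Import all_boot all_order all_algebra all_fingroup.
From Stdlib Require Import Classical IndefiniteDescription.

Set Implicit Arguments.
Unset Strict Implicit.
Unset Printing Implicit Defensive.

Import GRing.Theory.
Local Open Scope ring_scope.

(* If B stands in one slot and A in all others, the polynomial evaluates to a
   combination of the matrices A^i B A^(k-1-i) whose coefficients form a column
   of Cof(p); as Cof(p) is invertible, Phi preserves in both directions the
   relation "A^i B A^(k-1-i) = 0 for all i". For A of rank one
   and nonzero trace this says AB = BA = 0. Applied to n mutually orthogonal
   matrices of this kind, it forces their images to be of the same kind.

   Two such matrices x f and x g have images with the same column space or the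
   same row space: inside a frame e_ij, compare a e_11 + b e_12 with the matrix
   e_33 + e_32, which is orthogonal to it. Connectedness makes this choice
   uniform, so that, up to transposition, Phi (x f) is proportional to
   p(x) q(f), where p and q act on points and hyperplanes and preserve incidence
   in both directions. The fundamental theorem of projective geometry, carried
   out in coordinates, yields a field homomorphism phi and T with p(x) ~ T x^phi
   and q(f) ~ f^phi T^-1. Finally, the image of a rank-one nilpotent is
   determined by its orthogonality to the images of traced rank-one matrices. *)

(** * Rank-one matrices and frames *)

Section RankOne.
Variable F : fieldType.

Definition dot n (f : 'rV[F]_n) (x : 'cV[F]_n) : F := (f *m x) 0 0.

Definition orth n (A B : 'M[F]_n) : Prop := A *m B = 0 /\ B *m A = 0.

Definition rank1_traced n (A : 'M[F]_n) : bool :=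
  (\rank A == 1%N) && (\tr A != 0).

Section Dot.
Variable n : nat.
Implicit Types (f g : 'rV[F]_n) (x y : 'cV[F]_n) (A B C : 'M[F]_n).

Lemma dotE f x : f *m x = (dot f x)%:M.
Proof. exact: mx11_scalar. Qed.

Lemma dot_sum f x : dot f x = \sum_j f 0 j * x j 0.
Proof. by rewrite /dot mxE. Qed.

Lemma dotDl f g x : dot (f + g) x = dot f x + dot g x.
Proof. by rewrite /dot mulmxDl mxE. Qed.

Lemma dotBl f g x : dot (f - g) x = dot f x - dot g x.
Proof. by rewrite /dot mulmxBl mxE [X in _ + X]mxE. Qed.

Lemma dotBr f x y : dot f (x - y) = dot f x - dot f y.
Proof. by rewrite /dot mulmxBr mxE [X in _ + X]mxE. Qed.

Lemma dotDr f x y : dot f (x + y) = dot f x + dot f y.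
Proof. by rewrite /dot mulmxDr mxE. Qed.

Lemma dotZl a f x : dot (a *: f) x = a * dot f x.
Proof. by rewrite /dot -scalemxAl mxE. Qed.

Lemma dotZr a f x : dot f (a *: x) = a * dot f x.
Proof. by rewrite /dot -scalemxAr mxE. Qed.

Lemma dot_tr f x : dot x^T f^T = dot f x.
Proof. by rewrite /dot -trmx_mul mxE. Qed.

Lemma dot0l x : dot 0 x = 0.
Proof. by rewrite /dot mul0mx mxE. Qed.

Lemma dot0r f : dot f 0 = 0.
Proof. by rewrite /dot mulmx0 mxE. Qed.

Lemma dot_mulmx f A x : dot (f *m A) x = dot f (A *m x).
Proof. by rewrite /dot mulmxA. Qed.

Lemma dot_deltal j x : dot (delta_mx 0 j) x = x j 0.
Proof. by rewrite /dot -rowE mxE. Qed.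

Lemma dot_deltar f j : dot f (delta_mx j 0) = f 0 j.
Proof. by rewrite /dot -colE mxE. Qed.

Lemma mul_outer x f y g : (x *m f) *m (y *m g) = dot f y *: (x *m g).
Proof. by rewrite mulmxA -(mulmxA x) dotE mul_mx_scalar -scalemxAl. Qed.

Lemma tr_outer x f : \tr (x *m f) = dot f x.
Proof. by rewrite mxtrace_mulC dotE mxtrace_scalar mulr1n. Qed.

Lemma outer_eq0 x f : (x *m f == 0) = (x == 0) || (f == 0).
Proof.
apply/eqP/orP => [xf0|[]/eqP->]; rewrite ?mul0mx ?mulmx0 //.
have [_|/cV0Pn[i xi]] := eqVneq x 0; first by left.
right; apply/eqP/rowP => l; move/matrixP/(_ i l): xf0.
rewrite !mxE big_ord1 => /eqP.
by rewrite mulf_eq0 (negPf xi) => /eqP.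
Qed.

Lemma rank_outer x f : x != 0 -> f != 0 -> \rank (x *m f) = 1%N.
Proof.
move=> x0 f0; apply/eqP; rewrite eqn_leq lt0n mxrank_eq0 outer_eq0.
by rewrite (negPf x0) (negPf f0) (leq_trans (mxrankM_maxl _ _)) ?rank_leq_col.
Qed.

Lemma rank1_outer A : \rank A = 1%N ->
  exists x f, [/\ x != 0, f != 0 & A = x *m f].
Proof.
move=> rA; have := mulmx_base A; move: (col_base A) (row_base A).
rewrite rA => x f Axf; exists x, f; split=> //; last first.
- by apply: contra_eq_neq rA => f0; rewrite -Axf f0 mulmx0 mxrank0.
- by apply: contra_eq_neq rA => x0; rewrite -Axf x0 mul0mx mxrank0.
Qed.

Lemma rank1_traced_outer x f : dot f x != 0 -> rank1_traced (x *m f).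
Proof.
move=> fx; rewrite /rank1_traced tr_outer fx andbT rank_outer //.
- by apply: contraNneq fx => ->; rewrite dot0r.
- by apply: contraNneq fx => ->; rewrite dot0l.
Qed.

Lemma rank1_tracedP A : rank1_traced A ->
  exists x f, dot f x != 0 /\ A = x *m f.
Proof.
case/andP=> /eqP/rank1_outer[x [f [_ _ ->]]]; rewrite tr_outer.
by exists x, f.
Qed.

Lemma rank1_traced_tr A : rank1_traced A^T = rank1_traced A.
Proof. by rewrite /rank1_traced mxrank_tr mxtrace_tr. Qed.

Lemma orth_tr A B : orth A^T B^T <-> orth A B.
Proof.
rewrite /orth -!trmx_mul; split=> -[AB BA]; split; apply/trmx_inj;
  by rewrite ?trmxK ?AB ?BA trmx0.
Qed.

Lemma orth_outer x f y g : dot f y = 0 -> dot g x = 0 ->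
  orth (x *m f) (y *m g).
Proof. by move=> fy gx; rewrite /orth !mul_outer fy gx !scale0r. Qed.

Lemma exists_dotl f : f != 0 -> exists x, dot f x != 0.
Proof.
case/rV0Pn=> j fj; exists (delta_mx j 0).
by rewrite dot_deltar.
Qed.

Lemma exists_dotr x : x != 0 -> exists f, dot f x != 0.
Proof.
case/cV0Pn=> j xj; exists (delta_mx 0 j).
by rewrite dot_deltal.
Qed.

(* A biorthogonal system of n vectors and n forms resolves the identity: the
   matrices Y and Z below satisfy Z Y = 1, hence Y Z = 1. *)
Lemma biorthogonal_resolution (y : 'I_n -> 'cV[F]_n) (z : 'I_n -> 'rV[F]_n) :
  (forall i j, i != j -> dot (z i) (y j) = 0) ->
  (forall i, dot (z i) (y i) != 0) ->
  \sum_i (dot (z i) (y i))^-1 *: (y i *m z i) = 1%:M.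
Proof.
move=> zy0 zy1.
pose Y := \matrix_(a, i) y i a 0.
pose Z := \matrix_(i, a) ((dot (z i) (y i))^-1 * z i 0 a).
have ZY : Z *m Y = 1%:M.
  apply/matrixP=> i j; rewrite !mxE.
  under eq_bigr do rewrite !mxE -mulrA.
  rewrite -mulr_sumr -dot_sum; case: eqVneq => [->|ij].
    by rewrite mulVf.
  by rewrite (zy0 _ _ ij) mulr0.
rewrite -(mulmx1C ZY); apply/matrixP=> a b; rewrite summxE mxE.
by apply: eq_bigr => i _; rewrite !mxE big_ord1 mulrCA.
Qed.

End Dot.

Lemma form_killing n (x : 'cV[F]_n) : (1 < n)%N ->
  exists2 f : 'rV[F]_n, f != 0 & dot f x = 0.
Proof.
move=> n1; have /rowV0Pn[f /sub_kermxP fx f0] : kermx x != 0.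
  by rewrite -mxrank_eq0 mxrank_ker subn_eq0 -ltnNge (leq_ltn_trans (rank_leq_col _)).
by exists f; rewrite // /dot fx mxE.
Qed.

Lemma vector_killed n (f : 'rV[F]_n) : (1 < n)%N ->
  exists2 x : 'cV[F]_n, x != 0 & dot f x = 0.
Proof.
move=> n1; have [g g0 gf] := form_killing f^T n1.
by exists g^T; rewrite ?trmx_eq0 // -dot_tr trmxK.
Qed.

End RankOne.

(** * Change of basis and adapted frames *)

Section Frames.
Variable F : fieldType.

(** The columns of [invmx W] are a frame and the rows of [W] its dual coframe, so
    [chbasis W (delta_mx i j)] is column [i] of the former times row [j] of the latter. *)
Definition chbasis n (W A : 'M[F]_n) : 'M[F]_n := invmx W *m A *m W.

Section ChangeOfBasis.
Variables (n : nat) (W : 'M[F]_n).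
Hypothesis Wu : W \in unitmx.
Implicit Types A B : 'M[F]_n.

Lemma chbasisM A B : chbasis W A *m chbasis W B = chbasis W (A *m B).
Proof. by rewrite /chbasis !mulmxA mulmxK // -!mulmxA. Qed.

Lemma chbasis_eq0 A : (chbasis W A == 0) = (A == 0).
Proof.
apply/eqP/eqP => [cA0|->]; last by rewrite /chbasis mulmx0 mul0mx.
have := congr1 (fun X => W *m X *m invmx W) cA0.
by rewrite /chbasis !mulmxA mulmxK // mulmxV // mul1mx mulmx0 mul0mx.
Qed.

Lemma orth_chbasis A B : orth (chbasis W A) (chbasis W B) <-> orth A B.
Proof.
by rewrite /orth !chbasisM; split=> -[/eqP AB /eqP BA]; split; apply/eqP;
  rewrite ?chbasis_eq0 // -chbasis_eq0.
Qed.

Lemma rank_chbasis A : \rank (chbasis W A) = \rank A.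
Proof.
by rewrite /chbasis mxrankMfree ?row_free_unit // eqmxMfull ?row_full_unit ?unitmx_inv.
Qed.

Lemma rank1_traced_chbasis A : rank1_traced (chbasis W A) = rank1_traced A.
Proof.
by rewrite /rank1_traced rank_chbasis /chbasis mxtrace_mulC mulmxA mulmxV // mul1mx.
Qed.

Lemma chbasis_outer (x : 'cV_n) (f : 'rV_n) :
  chbasis W (x *m f) = (invmx W *m x) *m (f *m W).
Proof. by rewrite /chbasis !mulmxA. Qed.

End ChangeOfBasis.

(** In the rank factorization of [f] the left factor is a scalar and the middle one selects row 0,
    so [f] is a multiple of row 0 of [row_ebase f]. *)
Lemma unitmx_with_row0 n (f : 'rV[F]_n.+1) : f != 0 ->
  exists2 W : 'M_n.+1, W \in unitmx & row 0 W = f.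
Proof.
move=> f0; have rf : \rank f = 1%N by rewrite rank_rV f0.
have := mulmx_ebase f; rewrite rf (mx11_scalar (col_ebase f)).
set c := col_ebase f 0 0 => fE.
have c0 : c != 0.
  by apply: contra_neq f0 => c0; rewrite -fE c0 raddf0 !mul0mx.
exists (c *: row_ebase f); first by rewrite unitmxZ ?row_ebase_unit // unitfE.
rewrite -[RHS]fE linearZ /= mul_scalar_mx -scalemxAl rowE; congr (_ *: (_ *m _)).
by apply/matrixP=> i [[|j] jn]; rewrite !mxE !ord1.
Qed.

Lemma frame_for_pair n (x : 'cV[F]_n.+1) (f : 'rV[F]_n.+1) : dot f x != 0 ->
  exists W : 'M_n.+1,
    [/\ W \in unitmx, row 0 W = f & W *m x = dot f x *: delta_mx 0 0].
Proof.
move=> fx; have f0 : f != 0 by apply: contraNneq fx => ->; rewrite dot0l.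
have [W0 W0u W0f] := unitmx_with_row0 f0.
pose v := W0 *m x; pose c := dot f x.
have v0 : v 0 0 = c by rewrite -dot_deltal -dot_mulmx -rowE W0f.
(* The shear [1 - N] keeps coordinate 0 of [v] and clears all others; [N] squares to zero because
   [u] vanishes at 0. *)
pose u := c^-1 *: v - delta_mx 0 0.
have u0 : u 0 0 = 0 by rewrite /u mxE mxE v0 mulVf // !mxE eqxx subrr.
pose N : 'M_n.+1 := u *m delta_mx 0 0.
have NN : N *m N = 0 by rewrite mul_outer dot_deltal u0 scale0r.
have LL : (1%:M - N) *m (1%:M + N) = 1%:M.
  by rewrite mulmxDl mulmxDr !mul1mx mulNmx mulmxDr mulmx1 NN addr0 addrK.
have [Lu _] := mulmx1_unit LL.
exists ((1%:M - N) *m W0); split; first by rewrite unitmx_mul Lu.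
- rewrite row_mul linearB /= row_mul [row 0 u]mx11_scalar mxE u0 raddf0 mul0mx subr0.
  by rewrite row1 -rowE W0f.
- rewrite -mulmxA -/v mulmxBl mul1mx -mulmxA dotE dot_deltal v0 mul_mx_scalar.
  by rewrite scalerBr scalerA mulfV // scale1r opprB addrC subrK.
Qed.

Lemma frame_for_triple n (x : 'cV[F]_n.+1) (f g : 'rV[F]_n.+1) : (0 < n)%N ->
  dot f x != 0 -> dot g x != 0 ->
  exists W : 'M_n.+1,
    [/\ W \in unitmx, row 0 W = f, W *m x = dot f x *: delta_mx 0 0 &
        exists (a b : F) (j : 'I_n.+1),
          [/\ g = (a *: delta_mx 0 0 + b *: delta_mx 0 j) *m W, a != 0 & j != 0]].
Proof.
move=> n0 fx gx; have [W [Wu Wf Wx]] := frame_for_pair fx.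
have [g' gE] : exists g', g = g' *m W.
  by exists (g *m invmx W); rewrite mulmxKV.
pose a := g' 0 0; have a0 : a != 0.
  apply: contra_neq gx => a0.
  by rewrite gE dot_mulmx Wx dotZr dot_deltar -/a a0 mulr0.
pose u := g' - a *: delta_mx 0 0.
have u0 : u 0 0 = 0 by rewrite /u !mxE mulr1 subrr.
have [uz|/rV0Pn[j uj]] := eqVneq u 0.
  exists W; split=> //; exists a, 0, ord_max; rewrite scale0r addr0.
  by rewrite gE -(subr0 g') -uz opprB addrC subrK -val_eqE /= -lt0n.
(* Coming from [w]: row [j] of [1 + N] is [u], so the new frame has [u *m W] as its row [j]. As [w]
   vanishes at 0 and [j != 0], row 0 and the image of [x] stay the same. *)
have j0 : j != 0 by apply: contraNneq uj => ->; rewrite u0.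
pose w := u - delta_mx 0 j; pose N : 'M_n.+1 := delta_mx j 0 *m w.
have wj : dot w (delta_mx j 0) = u 0 j - 1.
  by rewrite dot_deltar !mxE !eqxx.
have w0 : dot w (delta_mx 0 0) = 0.
  by rewrite dot_deltar /w mxE u0 !mxE [0 == j]eq_sym (negPf j0) subr0.
have MM : (1%:M + N) *m (1%:M - (u 0 j)^-1 *: N) = 1%:M.
  rewrite mulmxDl mul1mx mulmxBr mulmx1 -scalemxAr mul_outer wj scalerA.
  rewrite mulrBr mulVf // mulr1 scalerBl scale1r opprB.
  by rewrite -/N [N + _]addrC subrK subrK.
have [Mu _] := mulmx1_unit MM.
exists ((1%:M + N) *m W); split.
- by rewrite unitmx_mul Mu.
- rewrite row_mul rowE mulmxDr mulmx1 mulmxA dotE dot_deltal mxE [0 == j]eq_sym (negPf j0).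
  by rewrite raddf0 mul0mx addr0 -rowE.
- rewrite -mulmxA Wx -scalemxAr mulmxDl mul1mx -mulmxA dotE w0 raddf0 mulmx0.
  by rewrite addr0.
exists a, 1, j; split=> //; rewrite gE mulmxA; congr (_ *m _).
rewrite scale1r mulmxDr mulmx1 mulmxA dotE dotDl dotZl !dot_deltal !mxE !eqxx.
rewrite [0 == j]eq_sym (negPf j0) mulr0 add0r mul1mx.
by rewrite -addrA [delta_mx 0 j + _]addrC subrK /u addrC subrK.
Qed.

End Frames.

(** * From zeros of the polynomial to orthogonality *)

Section Sandwich.
Variables (F : fieldType) (n : nat).
Implicit Types A B : 'M[F]_n.

Definition sandwich k A B : Prop :=
  forall i : 'I_k, A ^+ i * B * A ^+ (k - i.+1) = 0.

Lemma prod_single_factor k (i0 : 'I_k) A B :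
  \prod_(i < k) (if i == i0 then B else A) = A ^+ i0 * B * A ^+ (k - i0.+1).
Proof.
rewrite -(big_mkord xpredT (fun i => if i == i0 :> nat then B else A)).
rewrite (@big_cat_nat _ _ _ i0) //=; last exact: ltnW.
rewrite [X in _ * X]big_ltn // eqxx mulrA; congr (_ * _ * _).
  rewrite -[in RHS](subn0 i0) -prodr_const_nat; apply: eq_big_nat => i.
  by case/andP=> _ /ltn_eqF ->.
rewrite -prodr_const_nat; apply: eq_big_nat => i.
by case/andP=> /gtn_eqF ->.
Qed.

(** Permutations are grouped by the position [i] at which variable [j] lands, that is [s i = j];
    their coefficients add up to [Cof alpha i j]. *)
Lemma mlpoly_eval_single k (alpha : 'S_k -> F) (j : 'I_k) A B :
  mlpoly_eval alpha (fun i => if i == j then B else A) =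
    \sum_i Cof alpha i j *: (A ^+ i * B * A ^+ (k - i.+1)).
Proof.
rewrite /mlpoly_eval (partition_big (fun s : 'S_k => (s^-1)%g j) xpredT) //=.
apply: eq_bigr => i _; rewrite mxE scaler_suml; apply: eq_big => s.
  by apply/eqP/eqP => [<-|<-]; rewrite ?permKV ?permK.
move/eqP=> <-; congr (_ *: _); rewrite -prod_single_factor; apply: eq_bigr => l _.
by congr (if _ then _ else _); apply/eqP/eqP => [<-|->]; rewrite ?permKV ?permK.
Qed.

(** The converse solves a linear system: weighting evaluation [j] by entry [(j, l)] of the inverse
    of [Cof alpha] isolates the [l]-th sandwich product. *)
Lemma sandwich_mlpoly k (alpha : 'S_k -> F) A B : Cof alpha \in unitmx ->
  sandwich k A B <->
  forall j, mlpoly_eval alpha (fun i => if i == j then B else A) = 0.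
Proof.
move=> Cu; split=> [AB j|AB l].
  by rewrite mlpoly_eval_single big1 // => i _; rewrite AB scaler0.
pose M i := A ^+ i * B * A ^+ (k - i.+1); rewrite -/(M l).
have -> : M l = \sum_i (Cof alpha *m invmx (Cof alpha)) i l *: M i.
  rewrite mulmxV // (bigD1 l) //= mxE eqxx scale1r big1 ?addr0 // => i il.
  by rewrite mxE (negPf il) scale0r.
under eq_bigr do rewrite mxE scaler_suml.
rewrite exchange_big big1 //= => j _.
under eq_bigr do rewrite mulrC -scalerA.
by rewrite -scaler_sumr -mlpoly_eval_single AB scaler0.
Qed.

Lemma outer_exp (x : 'cV[F]_n) (f : 'rV_n) m :
  (x *m f) ^+ m.+1 = dot f x ^+ m *: (x *m f).
Proof.
elim: m => [|m IH]; first by rewrite expr0 scale1r.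
by rewrite exprS IH -mulmxE -scalemxAr mul_outer scalerA -exprSr.
Qed.

(** The extreme positions of [B] give [A^(k+1) B = 0] and [B A^(k+1) = 0], and positive powers of a
    traced rank-one matrix are nonzero multiples of it. Conversely, at every position some [A]
    stands next to [B]. *)
Lemma sandwich_rank1_traced k A B : rank1_traced A ->
  sandwich k.+2 A B <-> orth A B.
Proof.
move/rank1_tracedP=> [x [f [fx ->]]]; split=> [AB|[AB BA] i].
  have c0 : dot f x ^+ k != 0 by rewrite expf_neq0.
  split; apply/eqP.
  - have /eqP := AB ord_max; rewrite /= subnn mulr1 outer_exp -mulmxE -scalemxAl.
    by rewrite scaler_eq0 (negPf c0).
  - have /eqP := AB ord0; rewrite /= subn1 mul1r outer_exp -mulmxE -scalemxAr.
    by rewrite scaler_eq0 (negPf c0).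
case: i => [[|i] ik] /=.
  by rewrite subn1 mul1r outer_exp -mulmxE -scalemxAr BA scaler0.
by rewrite outer_exp -mulmxE -scalemxAl AB scaler0 mul0mx.
Qed.

Lemma sandwich_self k A : sandwich k.+1 A A <-> A ^+ k.+1 = 0.
Proof.
suff E (i : 'I_k.+1) : A ^+ i * A * A ^+ (k.+1 - i.+1) = A ^+ k.+1.
  by split=> [/(_ ord0)|A0 i]; rewrite E.
by rewrite -exprSr -exprD subnKC.
Qed.

(* Picking w_i and x_i with w_i Q_i^(k+2) x_i <> 0, the vectors Q_i x_i and the
   forms w_i Q_i^(k+1) are biorthogonal; multiplying the resulting resolution of
   the identity by Q_j leaves a single rank-one summand. *)
Lemma sandwich_family k (Q : 'I_n -> 'M[F]_n) :
  (forall i, ~ sandwich k.+2 (Q i) (Q i)) ->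
  (forall i j, i != j -> sandwich k.+2 (Q i) (Q j)) ->
  forall i, rank1_traced (Q i).
Proof.
move=> QQ Qij.
have QR i j : i != j -> Q i ^+ k.+1 * Q j = 0.
  by move=> ij; have := Qij i j ij ord_max; rewrite /= subnn mulr1.
have RQ i j : i != j -> Q j * Q i ^+ k.+1 = 0.
  by move=> ij; have := Qij i j ij ord0; rewrite /= subn1 mul1r.
have Qk i : exists ab : 'I_n * 'I_n, (Q i ^+ k.+2) ab.1 ab.2 != 0.
  have /matrix0Pn[a [b Qab]] : Q i ^+ k.+2 != 0.
    by apply/eqP => /sandwich_self; apply: QQ.
  by exists (a, b).
have [ab Qab] := fin_all_exists Qk.
pose y i : 'cV_n := Q i *m delta_mx (ab i).2 0.
pose z i : 'rV_n := delta_mx 0 (ab i).1 *m Q i ^+ k.+1.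
have zy i : dot (z i) (y i) = (Q i ^+ k.+2) (ab i).1 (ab i).2.
  by rewrite dot_mulmx mulmxA dot_deltal -colE mxE mulmxE -exprSr.
have res : \sum_i (dot (z i) (y i))^-1 *: (y i *m z i) = 1%:M.
  apply: biorthogonal_resolution => [i j ij|i]; last by rewrite zy.
  by rewrite dot_mulmx mulmxA mulmxE QR // mul0mx dot0r.
move=> j.
have QE : Q j = y j *m ((dot (z j) (y j))^-1 *: (z j *m Q j)).
  rewrite -[LHS]mul1mx -res mulmx_suml (bigD1 j) //= big1 ?addr0 => [|i ij].
    by rewrite -[in LHS]scalemxAl -[in RHS]scalemxAr -mulmxA.
  by rewrite -scalemxAl -mulmxA -(mulmxA _ _ (Q j)) mulmxE QR // !mulmx0 scaler0.
rewrite QE; apply: rank1_traced_outer; apply/eqP => d0.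
by apply: (QQ j); apply/sandwich_self; rewrite QE outer_exp exprS d0 mul0r scale0r.
Qed.

End Sandwich.

(** The second matrix [B] may be nilpotent; this later pins down the images of nilpotent rank-one
    matrices. *)
Definition orth_preserving (F : fieldType) n (Phi : 'M[F]_n -> 'M[F]_n) : Prop :=
  (forall A, rank1_traced A -> rank1_traced (Phi A)) /\
  (forall A B, rank1_traced A -> \rank B = 1%N ->
     orth A B <-> orth (Phi A) (Phi B)).

Lemma rank1_traced_rank (F : fieldType) n (A : 'M[F]_n) :
  rank1_traced A -> \rank A = 1%N.
Proof. by case/andP=> /eqP. Qed.

Lemma rank1_traced_delta (F : fieldType) n (c : F) (i j : 'I_n) : c != 0 ->
  rank1_traced (c *: delta_mx i j : 'M[F]_n) = (i == j).
Proof.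
move=> c0; rewrite /rank1_traced mxtraceZ mulf_eq0 (negPf c0) mxrank_scale_nz //.
rewrite mxrank_delta eqxx -(mul_delta_mx (0 : 'I_1)) tr_outer dot_deltar mxE eqxx.
by case: (i == j); rewrite ?oner_eq0 ?eqxx.
Qed.

Lemma orth_delta (F : fieldType) n (c d : F) (i j : 'I_n) : i != j ->
  orth (c *: delta_mx i i : 'M[F]_n) (d *: delta_mx j j).
Proof.
move=> ij; rewrite /orth -!scalemxAl -!scalemxAr !mul_delta_mx_0 ?scaler0 //.
by rewrite eq_sym.
Qed.

Lemma orth_preserving_of_sandwich (F : fieldType) n k (Phi : 'M[F]_n.+1 -> 'M[F]_n.+1) :
  (forall A B, \rank A = 1%N -> \rank B = 1%N ->
     sandwich k.+2 A B <-> sandwich k.+2 (Phi A) (Phi B)) ->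
  orth_preserving Phi.
Proof.
move=> sPhi.
suff P1 A : rank1_traced A -> rank1_traced (Phi A).
  split=> // A B A1 B1.
  rewrite -(sandwich_rank1_traced k) // (sPhi A B (rank1_traced_rank A1) B1).
  exact/sandwich_rank1_traced/P1.
move=> A1; have [x [f [fx AE]]] := rank1_tracedP A1.
have [W [Wu Wf Wx]] := frame_for_pair fx.
(* A full family of mutually orthogonal matrices through [A]; the scalar makes member 0 equal to [A]
   itself. *)
pose E i := chbasis W (dot f x *: delta_mx i i).
have E1 i : rank1_traced (E i) by rewrite rank1_traced_chbasis // rank1_traced_delta.
have -> : A = E 0.
  rewrite AE /E -(mul_delta_mx (0 : 'I_1)) scalemxAl chbasis_outer -Wx mulKmx //.
  by rewrite -rowE Wf.
move: (0) => i; apply: (@sandwich_family _ _ k (Phi \o E)) => {i} [i|i j ij] /=.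
  rewrite -sPhi ?rank1_traced_rank // sandwich_rank1_traced // orth_chbasis //.
  rewrite /orth -scalemxAl -scalemxAr mul_delta_mx scalerA => -[/eqP + _].
  by rewrite scaler_eq0 mulf_eq0 (negPf fx) -mxrank_eq0 mxrank_delta.
rewrite -sPhi ?rank1_traced_rank // sandwich_rank1_traced // orth_chbasis //.
exact: orth_delta.
Qed.

(** * Adjacency *)

Section Adjacency.
Variable F : fieldType.

(** [tr_after] exchanges row and column spaces of the images, [tr_before] exchanges vectors and
    forms in the arguments; both give dual versions of a statement for free. *)
Definition tr_after n (Phi : 'M[F]_n -> 'M[F]_n) A := (Phi A)^T.
Definition tr_before n (Phi : 'M[F]_n -> 'M[F]_n) A := Phi A^T.

Lemma orth_preserving_tr_after n (Phi : 'M[F]_n -> 'M[F]_n) :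
  orth_preserving Phi -> orth_preserving (tr_after Phi).
Proof.
case=> P1 P2; split=> [A A1|A B A1 B1]; first by rewrite rank1_traced_tr P1.
by rewrite P2 // -orth_tr.
Qed.

Lemma orth_preserving_tr_before n (Phi : 'M[F]_n -> 'M[F]_n) :
  orth_preserving Phi -> orth_preserving (tr_before Phi).
Proof.
case=> P1 P2; split=> [A A1|A B A1 B1]; first by rewrite P1 ?rank1_traced_tr.
by rewrite -orth_tr P2 ?rank1_traced_tr ?mxrank_tr.
Qed.

Lemma orth_preserving_chbasis n (Phi : 'M[F]_n -> 'M[F]_n) W : W \in unitmx ->
  orth_preserving Phi -> orth_preserving (Phi \o chbasis W).
Proof.
move=> Wu [P1 P2]; split=> [A A1|A B A1 B1] /=.
  by rewrite P1 ?rank1_traced_chbasis.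
by rewrite -P2 ?rank1_traced_chbasis ?rank_chbasis // orth_chbasis.
Qed.

(* With F_s the image of the s-th diagonal unit and B', C' those of
   a e_ii + b e_ij and e_ll + e_lj, orthogonality gives B' F_j C' = 0 = C' F_j B',
   while F_j C' = 0 = C' F_j is excluded since e_ll + e_lj is not orthogonal
   to e_jj; hence B' F_j = 0 or F_j B' = 0. *)
Lemma adjacent_units n (Phi : 'M[F]_n -> 'M[F]_n) (i j l : 'I_n) (a b c : F) :
  orth_preserving Phi -> i != j -> i != l -> j != l -> a != 0 -> c != 0 ->
  let A := Phi (c *: delta_mx i i) in
  let B := Phi (a *: delta_mx i i + b *: delta_mx i j) in
  (B <= A)%MS \/ (B^T <= A^T)%MS.
Proof.
move=> [P1 P2] ij il jl a0 c0; pose E s : 'M[F]_n := c *: delta_mx s s.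
have E1 s : rank1_traced (E s) by rewrite rank1_traced_delta ?eqxx.
pose f : 'rV[F]_n := a *: delta_mx 0 i + b *: delta_mx 0 j.
pose g : 'rV[F]_n := delta_mx 0 l + delta_mx 0 j.
have EE s : E s = (c *: delta_mx s 0) *m delta_mx (0 : 'I_1) s.
  by rewrite -scalemxAl mul_delta_mx.
have BE : a *: delta_mx i i + b *: delta_mx i j = delta_mx i (0 : 'I_1) *m f.
  by rewrite mulmxDr -!scalemxAr !mul_delta_mx.
rewrite -/(E i) BE /=; set B0 := _ *m f; pose C0 : 'M[F]_n := delta_mx l 0 *m g.
have B1 : rank1_traced B0.
  apply: rank1_traced_outer; rewrite dot_deltar !mxE !eqxx (negPf ij) /=.
  by rewrite mulr1 mulr0 addr0.
have C1 : rank1_traced C0.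
  apply: rank1_traced_outer; rewrite dot_deltar !mxE !eqxx [l == j]eq_sym (negPf jl) /=.
  by rewrite addr0 oner_eq0.
have BCo : orth B0 C0.
  apply: orth_outer; rewrite dot_deltar !mxE /=.
    by rewrite ![l == _]eq_sym (negPf il) (negPf jl) !mulr0 addr0.
  by rewrite (negPf il) (negPf ij) addr0.
have BEo s : s != i -> s != j -> orth B0 (E s).
  move=> si sj; rewrite EE; apply: orth_outer.
    by rewrite dotZr dot_deltar !mxE /= (negPf si) (negPf sj) !mulr0 addr0 mulr0.
  by rewrite dot_deltar !mxE /= [i == s]eq_sym (negPf si).
have CEo : orth C0 (E i).
  rewrite EE; apply: orth_outer.
    by rewrite dotZr dot_deltar !mxE /= (negPf il) (negPf ij) addr0 mulr0.
  by rewrite dot_deltar !mxE /= eq_sym (negPf il).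
have CEj : ~ orth C0 (E j).
  case=> /eqP + _; rewrite EE mul_outer dotZr dot_deltar !mxE !eqxx /= (negPf jl).
  rewrite add0r mulr1 scaler_eq0 (negPf c0) outer_eq0 /= => /orP[]/eqP.
    by move/matrixP/(_ l 0); rewrite !mxE !eqxx => /eqP; rewrite oner_eq0.
  by move/matrixP/(_ 0 j); rewrite !mxE !eqxx => /eqP; rewrite oner_eq0.
have PO A B : rank1_traced A -> rank1_traced B -> orth A B -> orth (Phi A) (Phi B).
  by move=> A1 D1 /P2; apply=> //; apply: rank1_traced_rank.
set B := Phi B0; pose C := Phi C0.
have yzE s : exists yz : 'cV[F]_n * 'rV[F]_n,
    dot yz.2 yz.1 != 0 /\ Phi (E s) = yz.1 *m yz.2.
  by have [y [z yz]] := rank1_tracedP (P1 _ (E1 s)); exists (y, z).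
have [yz yzP] := fin_all_exists yzE.
pose y s := (yz s).1; pose z s := (yz s).2.
have zy s : dot (z s) (y s) != 0 by case: (yzP s).
have PE s : Phi (E s) = y s *m z s by case: (yzP s).
have res : \sum_s (dot (z s) (y s))^-1 *: Phi (E s) = 1%:M.
  under eq_bigr do rewrite PE.
  apply: biorthogonal_resolution => // s t st.
  have [] := PO (E s) (E t) (E1 s) (E1 t) (orth_delta _ _ st).
  rewrite !PE mul_outer => /eqP; rewrite scaler_eq0 => /orP[/eqP//|].
  rewrite outer_eq0 => /orP[]/eqP yz0; move: (zy s) (zy t).
    by rewrite yz0 dot0r eqxx.
  by rewrite yz0 dot0l eqxx.
have BF s : s != i -> s != j -> B *m Phi (E s) = 0.
  by move=> si sj; have [] := PO _ _ B1 (E1 s) (BEo s si sj).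
have FB s : s != i -> s != j -> Phi (E s) *m B = 0.
  by move=> si sj; have [] := PO _ _ B1 (E1 s) (BEo s si sj).
have [CF FC] := PO _ _ C1 (E1 i) CEo.
have [BC CB] := PO _ _ B1 C1 BCo.
(* Inserting the resolution of the identity between [X] and [Y] leaves only the terms of [i] and
   [j]. *)
have expand (X Y : 'M_n) : 
  (forall s, s != i -> s != j -> X *m Phi (E s) = 0 \/ Phi (E s) *m Y = 0) ->
  X *m Y = (dot (z i) (y i))^-1 *: (X *m Phi (E i) *m Y) +
           (dot (z j) (y j))^-1 *: (X *m Phi (E j) *m Y).
  move=> XY0; rewrite -[X in X *m Y]mulmx1 -res mulmx_sumr mulmx_suml.
  rewrite (bigD1 i) //= (bigD1 j) 1?eq_sym //= big1 ?addr0 => [|s /andP[si sj]].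
    by rewrite -!scalemxAr -!scalemxAl.
  rewrite -scalemxAr -scalemxAl; case: (XY0 s si sj) => [->|].
    by rewrite mul0mx scaler0.
  by rewrite -mulmxA => ->; rewrite mulmx0 scaler0.
have BFC : B *m y j = 0 \/ z j *m C = 0.
  have /esym := expand B C (fun s si sj => or_introl (BF s si sj)).
  rewrite BC -mulmxA FC mulmx0 scaler0 add0r => /eqP.
  rewrite scaler_eq0 invr_eq0 (negPf (zy j)) PE -!mulmxA mulmxA outer_eq0 /=.
  by case/orP=> /eqP; [left | right].
have CFB : C *m y j = 0 \/ z j *m B = 0.
  have /esym := expand C B (fun s si sj => or_intror (FB s si sj)).
  rewrite CB CF mul0mx scaler0 add0r => /eqP.
  rewrite scaler_eq0 invr_eq0 (negPf (zy j)) PE -!mulmxA mulmxA outer_eq0 /=.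
  by case/orP=> /eqP; [left | right].
have caseB : B *m y j = 0 \/ z j *m B = 0.
  case: BFC CFB => [|zC]; first by left.
  case=> [Cy|]; last by right.
  case: CEj; apply/P2; rewrite ?rank1_traced_rank //.
  by rewrite /orth PE mulmxA -(mulmxA (y j)) Cy zC mul0mx mulmx0.
(* With the identity as the other factor only the [i] term survives, so [B] is a multiple of [B F_i]
   or of [F_i B]. *)
case: caseB => [By|zB]; [left|right].
  have := expand B 1%:M (fun s si sj => or_introl (BF s si sj)).
  rewrite !mulmx1 (PE j) [B *m (y j *m _)]mulmxA By mul0mx scaler0 addr0 => ->.
  by rewrite scalemx_sub ?submxMl.
have := expand 1%:M B (fun s si sj => or_intror (FB s si sj)).
rewrite !mul1mx (PE j) -[_ *m z j *m B]mulmxA zB mulmx0 scaler0 addr0 => ->.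
by rewrite linearZ /= trmx_mul scalemx_sub ?submxMl.
Qed.

Lemma exists_third n (i j : 'I_n.+3) : exists2 l, l != i & l != j.
Proof.
have : (0 < #|[predC pred2 i j]|)%N.
  have := cardC (pred2 i j); rewrite card_ord card2 => /eqP.
  by case: #|_| => //; rewrite addn0; case: (i != j).
by case/card_gt0P=> l; rewrite !inE negb_or => /andP[]; exists l.
Qed.

(** In the frame of [frame_for_triple] the two matrices become a multiple of [e_00] and a
    combination of [e_00] and [e_0j], as in [adjacent_units]. *)
Lemma adjacent_outer n (Phi : 'M[F]_n.+3 -> 'M[F]_n.+3) x f g :
  orth_preserving Phi -> dot f x != 0 -> dot g x != 0 ->
  (Phi (x *m g) <= Phi (x *m f))%MS \/ ((Phi (x *m g))^T <= (Phi (x *m f))^T)%MS.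
Proof.
move=> oP fx gx.
have [W [Wu Wf Wx [a [b [j [gE a0 j0]]]]]] := frame_for_triple (ltn0Sn _) fx gx.
have [l l0 lj] := exists_third 0 j.
have xE : x = invmx W *m (dot f x *: delta_mx 0 0) by rewrite -Wx mulKmx.
have fE : x *m f = chbasis W (dot f x *: delta_mx 0 0).
  rewrite -(mul_delta_mx (0 : 'I_1)) scalemxAl chbasis_outer -xE.
  by rewrite -rowE Wf.
have gE' : x *m g =
    chbasis W ((dot f x * a) *: delta_mx 0 0 + (dot f x * b) *: delta_mx 0 j).
  rewrite [X in chbasis W X](_ : _ = (dot f x *: delta_mx 0 (0 : 'I_1)) *m
      (a *: delta_mx 0 0 + b *: delta_mx 0 j)); last first.
    rewrite mulmxDr -!scalemxAr -!scalemxAl !mul_delta_mx !scalerA.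
    by rewrite ![a * _]mulrC ![b * _]mulrC.
  by rewrite chbasis_outer -xE -gE.
rewrite fE gE'; apply: (adjacent_units (l := l) _ (orth_preserving_chbasis Wu oP)).
- by rewrite eq_sym.
- by rewrite eq_sym.
- by rewrite eq_sym.
- by rewrite mulf_neq0.
- by [].
Qed.

End Adjacency.

(** * Uniformity of the type and the induced projectivities *)

Section Types.
Variable F : closedFieldType.

(* The vector (1, t, t^2, ...) for a non-root t of the product of the
   polynomials with coefficient vectors fs. *)
Lemma generic_vector n (fs : seq 'rV[F]_n) : all (fun f => f != 0) fs ->
  exists x, all (fun f => dot f x != 0) fs.
Proof.
move=> /allP fs0.
have /closed_nonrootP[t] : \prod_(f <- fs) rVpoly f != 0.
  rewrite big_seq prodf_seq_neq0; apply/allP=> f /fs0 f0; apply/implyP=> _.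
  by apply: contra_neq f0 => f0; rewrite -[f]rVpolyK f0 linear0.
rewrite -(big_map (@rVpoly F n) xpredT id) root_bigmul all_map => /allP tP.
exists (\col_i t ^+ i); apply/allP=> f /tP /=; apply: contraNneq.
rewrite dot_sum /root horner_poly => fx0; apply/eqP; rewrite -[RHS]fx0.
apply: eq_bigr => i _.
by rewrite mxE insubT //= => i_n; congr (f _ _ * _); apply: val_inj.
Qed.

Lemma generic_form n (xs : seq 'cV[F]_n) : all (fun x => x != 0) xs ->
  exists f, all (fun x => dot f x != 0) xs.
Proof.
move=> xs0; have : all (fun f => f != 0) (map trmx xs).
  by rewrite all_map; apply: sub_all xs0 => x; rewrite /= trmx_eq0.
case/generic_vector=> x; rewrite all_map => xP; exists x^T.
by apply: sub_all xP => y /=; rewrite -dot_tr trmxK.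
Qed.

(** Transposes turn row-space inclusion into inclusion of column spaces. The row-space version is
    the same predicate for [tr_after Phi]. *)
Definition vector_col n (Phi : 'M[F]_n -> 'M[F]_n) (x : 'cV[F]_n) : Prop :=
  forall f g, dot f x != 0 -> dot g x != 0 ->
    ((Phi (x *m g))^T <= (Phi (x *m f))^T)%MS.

Definition form_col n (Phi : 'M[F]_n -> 'M[F]_n) (f : 'rV[F]_n) : Prop :=
  forall x y, dot f x != 0 -> dot f y != 0 ->
    ((Phi (y *m f))^T <= (Phi (x *m f))^T)%MS.

Lemma form_col_tr_before n (Phi : 'M[F]_n -> 'M[F]_n) x :
  form_col (tr_before Phi) x^T <-> vector_col Phi x.
Proof.
split=> H f g fx gx.
  have := H f^T g^T; rewrite !dot_tr /tr_before !trmx_mul !trmxK; exact.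
by rewrite /tr_before !trmx_mul !trmxK H // -dot_tr trmxK.
Qed.

Lemma vector_col_tr_before n (Phi : 'M[F]_n -> 'M[F]_n) f :
  vector_col (tr_before Phi) f^T <-> form_col Phi f.
Proof.
split=> H x y fx fy.
  have := H x^T y^T; rewrite !dot_tr /tr_before !trmx_mul !trmxK; exact.
by rewrite /tr_before !trmx_mul !trmxK H // -dot_tr trmxK.
Qed.

Lemma rank1_submx_sym m1 m2 n (A : 'M[F]_(m1, n)) (B : 'M[F]_(m2, n)) :
  \rank A = 1%N -> \rank B = 1%N -> (A <= B)%MS -> (B <= A)%MS.
Proof.
by move=> rA rB AB; rewrite -(geq_leqif (mxrank_leqif_sup AB)) rA rB.
Qed.

(** Sharing a row space and sharing a column space are equivalence relations on these images whose
    union relates any two of them, so one of them already relates them all. *)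
Lemma vector_type n (Phi : 'M[F]_n.+3 -> 'M[F]_n.+3) x : orth_preserving Phi ->
  vector_col Phi x \/ vector_col (tr_after Phi) x.
Proof.
move=> oP; have [|nc] := classic (vector_col Phi x); [by left|right].
have Pr f : dot f x != 0 -> \rank (Phi (x *m f)) = 1%N.
  by move=> fx; apply/rank1_traced_rank/(proj1 oP)/rank1_traced_outer.
have {nc} [f0 [g0 [fx0 gx0 nfg]]] : exists f0 g0, [/\ dot f0 x != 0, dot g0 x != 0 &
    ~ ((Phi (x *m g0))^T <= (Phi (x *m f0))^T)%MS].
  apply: NNPP => H; apply: nc => f g fx gx; apply: NNPP => nfg; apply: H.
  by exists f, g.
have fg0 : (Phi (x *m g0) <= Phi (x *m f0))%MS.
  by case: (adjacent_outer oP fx0 gx0).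
have toF f : dot f x != 0 -> (Phi (x *m f) <= Phi (x *m f0))%MS.
  move=> fx; case: (adjacent_outer oP fx0 fx) => // ff0.
  case: (adjacent_outer oP gx0 fx) => [fg|fg]; first exact: submx_trans fg fg0.
  case: nfg; apply: submx_trans ff0.
  by apply: rank1_submx_sym fg; rewrite mxrank_tr Pr.
move=> f g fx gx; rewrite /tr_after !trmxK (submx_trans (toF g gx)) //.
by apply: rank1_submx_sym (toF f fx); rewrite Pr.
Qed.

Lemma form_type n (Phi : 'M[F]_n.+3 -> 'M[F]_n.+3) f : orth_preserving Phi ->
  form_col Phi f \/ form_col (tr_after Phi) f.
Proof.
move/orth_preserving_tr_before/(vector_type f^T).
case=> [/vector_col_tr_before|H]; [by left | right].
exact/(vector_col_tr_before (tr_after Phi)).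
Qed.

(* Otherwise, walking from a pair (x, f) through (x, h) and (y, h) to (y, g),
   with f y = 0 and g x = 0, the images of two orthogonal matrices would have
   the same column space. *)
Lemma not_all_col n (Phi : 'M[F]_n -> 'M[F]_n) x y h u : orth_preserving Phi ->
  vector_col Phi x -> vector_col Phi y -> form_col Phi h ->
  dot h x != 0 -> dot h y != 0 -> dot u x = 0 -> dot u y != 0 -> False.
Proof.
move=> [P1 P2] cx cy ch hx hy ux uy.
pose f := h - (dot h y / dot u y) *: u.
have fx : dot f x = dot h x by rewrite dotBl dotZl ux mulr0 subr0.
have fy : dot f y = 0 by rewrite dotBl dotZl divfK // subrr.
have fx0 : dot f x != 0 by rewrite fx.
have A1 := rank1_traced_outer fx0; have B1 := rank1_traced_outer uy.
have [AB _] : orth (Phi (x *m f)) (Phi (y *m u)).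
  by apply: (proj1 (P2 _ _ A1 (rank1_traced_rank B1))); apply: orth_outer.
have : ((Phi (x *m f))^T <= (Phi (y *m u))^T)%MS.
  apply: (submx_trans (cx _ _ hx fx0)).
  by apply: (submx_trans (ch _ _ hy hx)); apply: cy.
(* The inclusion writes [Phi (x *m f)] as [Phi (y *m u)] times a matrix; orthogonality then makes
   its square zero although its trace is not. *)
case/submxP=> D /(congr1 trmx); rewrite trmx_mul !trmxK => AE.
have [v [k [kv vk]]] := rank1_tracedP (P1 _ A1).
have /eqP : Phi (x *m f) *m Phi (x *m f) = 0 by rewrite {2}AE mulmxA AB mul0mx.
rewrite vk mul_outer scaler_eq0 (negPf kv) -vk -mxrank_eq0.
by rewrite (rank1_traced_rank (P1 _ A1)).
Qed.

(** By [not_all_col], a generic vector [y] and, dually, a generic form [g] are of row type. A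
    generic [z] then contradicts [not_all_col] in either type: with [x] and [h] for [Phi], or with
    [y] and [g] for [tr_after Phi]. *)
Lemma vector_form_types n (Phi : 'M[F]_n.+3 -> 'M[F]_n.+3) x h :
  orth_preserving Phi -> dot h x != 0 -> vector_col Phi x -> form_col Phi h ->
  False.
Proof.
move=> oP hx cx ch.
have oPa := orth_preserving_tr_after oP; have oPb := orth_preserving_tr_before oP.
have x0 : x != 0 by apply: contraNneq hx => ->; rewrite dot0r.
have h0 : h != 0 by apply: contraNneq hx => ->; rewrite dot0l.
have [u u0 ux] := form_killing x (isT : 1 < n.+3)%N.
have [w w0 hw] := vector_killed h (isT : 1 < n.+3)%N.
have [|y /and3P[hy uy _]] := @generic_vector _ [:: h; u]; first by rewrite /= h0 u0.
have y0 : y != 0 by apply: contraNneq hy => ->; rewrite dot0r.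
have ry : vector_col (tr_after Phi) y.
  have [cy|//] := vector_type y oP.
  by case: (not_all_col oP cx cy ch hx hy ux uy).
have [|g /and4P[gx gy gw _]] := @generic_form _ [:: x; y; w].
  by rewrite /= x0 y0 w0.
have rg : form_col (tr_after Phi) g.
  have [cg|//] := form_type g oP.
  case: (@not_all_col _ _ h^T g^T x^T w^T oPb); rewrite ?dot_tr //.
  - exact/vector_col_tr_before.
  - exact/vector_col_tr_before.
  - exact/form_col_tr_before.
have g0 : g != 0 by apply: contraNneq gx => ->; rewrite dot0l.
have [v v0 vy] := form_killing y (isT : 1 < n.+3)%N.
have [|z /and5P[hz gz uz vz _]] := @generic_vector _ [:: h; g; u; v].
  by rewrite /= h0 g0 u0 v0.
have [cz|rz] := vector_type z oP.
  exact: (not_all_col oP cx cz ch hx hz ux uz).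
exact: (not_all_col oPa ry rz rg gy gz vy vz).
Qed.

(** A form that is nonzero at a column-type vector has row type. A form [h] nonzero at both [x0] and
    [x] thus has row type, which excludes row type for [x]. *)
Lemma global_type n (Phi : 'M[F]_n.+3 -> 'M[F]_n.+3) x0 : orth_preserving Phi ->
  x0 != 0 -> vector_col Phi x0 ->
  (forall x, vector_col Phi x) /\ (forall f, form_col (tr_after Phi) f).
Proof.
move=> oP x00 cx0; have oPa := orth_preserving_tr_after oP.
have toform x f : vector_col Phi x -> dot f x != 0 -> form_col (tr_after Phi) f.
  by move=> cx fx; have [cf|//] := form_type f oP; case: (vector_form_types oP fx cx cf).
have cV x : vector_col Phi x.
  have [->|x1] := eqVneq x 0; first by move=> f g; rewrite dot0r eqxx.
  have [|h /and3P[hx0 hx _]] := @generic_form _ [:: x0; x]; first by rewrite /= x00 x1.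
  have [//|rx] := vector_type x oP.
  by case: (vector_form_types oPa hx rx (toform x0 h cx0 hx0)).
split=> // f; have [->|f0] := eqVneq f 0; first by move=> x y; rewrite dot0l eqxx.
by have [x fx] := exists_dotl f0; apply: toform (cV x) fx.
Qed.

(** [p x] spans the column space common to the images for fixed [x], and [q f] the row space common
    to those for fixed [f]. Nonincidence shows in the nonzero trace, incidence through an orthogonal
    pair. *)
Lemma projectivities n (Phi : 'M[F]_n.+3 -> 'M[F]_n.+3) : orth_preserving Phi ->
  (forall x, vector_col Phi x) -> (forall f, form_col (tr_after Phi) f) ->
  exists (p : 'cV[F]_n.+3 -> 'cV[F]_n.+3) (q : 'rV[F]_n.+3 -> 'rV[F]_n.+3),
    (forall x f, dot f x != 0 -> exists c, Phi (x *m f) = c *: (p x *m q f)) /\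
    (forall x f, x != 0 -> f != 0 -> (dot (q f) (p x) == 0) = (dot f x == 0)).
Proof.
move=> oP cV rf; have [P1 P2] := oP.
have pE (x : 'cV_n.+3) : exists u : 'cV[F]_n.+3, x != 0 -> u != 0 /\
    forall f, dot f x != 0 -> ((Phi (x *m f))^T <= u^T)%MS.
  have [->|x0] := eqVneq x 0; first by exists 0.
  have [f fx] := exists_dotr x0.
  have [u [v [vu uv]]] := rank1_tracedP (P1 _ (rank1_traced_outer fx)).
  exists u => _; split; first by apply: contraNneq vu => ->; rewrite dot0r.
  by move=> g gx; apply: submx_trans (cV x f g fx gx) _; rewrite uv trmx_mul submxMl.
have qE (f : 'rV_n.+3) : exists v : 'rV[F]_n.+3, f != 0 -> v != 0 /\
    forall x, dot f x != 0 -> (Phi (x *m f) <= v)%MS.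
  have [->|f0] := eqVneq f 0; first by exists 0.
  have [x fx] := exists_dotl f0.
  have [u [v [vu uv]]] := rank1_tracedP (P1 _ (rank1_traced_outer fx)).
  exists v => _; split; first by apply: contraNneq vu => ->; rewrite dot0l.
  move=> y fy; have := rf f x y fx fy; rewrite /tr_after !trmxK => H.
  by apply: submx_trans H _; rewrite uv submxMl.
have [p pP] := functional_choice _ pE; have [q qP] := functional_choice _ qE.
have nz (x : 'cV_n.+3) (f : 'rV[F]_n.+3) : dot f x != 0 -> x != 0 /\ f != 0.
  by move=> fx; split; apply: contraNneq fx => ->; rewrite ?dot0r ?dot0l.
have PE x f : dot f x != 0 -> exists c, Phi (x *m f) = c *: (p x *m q f).
  move=> fx; have [x0 f0] := nz x f fx.
  have [_ /(_ f fx)/submxP[D /(congr1 trmx)]] := pP x x0.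
  rewrite trmx_mul !trmxK => ED.
  have /submxP[w Ew] := proj2 (qP f f0) x fx.
  have /cV0Pn[k pk] := proj1 (pP x x0).
  have DE : p x k 0 *: D^T = w k 0 *: q f.
    by rewrite -!mul_scalar_mx -!dot_deltal -!dotE -!mulmxA -Ew ED.
  exists ((p x k 0)^-1 * w k 0).
  by rewrite ED -scalerA scalemxAr scalemxAr -DE scalerA mulVf // scale1r.
have Pnz x f : dot f x != 0 -> Phi (x *m f) != 0.
  by move=> fx; rewrite -mxrank_eq0 (rank1_traced_rank (P1 _ (rank1_traced_outer fx))).
exists p, q; split=> // x f x0 f0.
have [fx|fx] := eqVneq (dot f x) 0; last first.
  have [c cE] := PE x f fx; have := P1 _ (rank1_traced_outer fx).
  by rewrite cE /rank1_traced mxtraceZ tr_outer mulf_eq0 negb_or => /and3P[_ _ /negPf].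
have [g gx] := exists_dotr x0; have [y0 fy0] := exists_dotl f0.
(* [y0] is corrected so that [g] kills it; as [f] kills [x], its value is kept, and [x *m g] is
   orthogonal to [y *m f]. *)
pose y := y0 - (dot g y0 / dot g x) *: x.
have gy : dot g y = 0.
  by rewrite dotBr dotZr divfK // subrr.
have fy : dot f y != 0.
  by rewrite dotBr dotZr fx mulr0 subr0.
have [_] : orth (Phi (x *m g)) (Phi (y *m f)).
  have A1 := rank1_traced_outer gx; have B1 := rank1_traced_outer fy.
  by apply: (proj1 (P2 _ _ A1 (rank1_traced_rank B1))); apply: orth_outer.
have [c cE] := PE _ _ gx; have [d dE] := PE _ _ fy.
have := Pnz _ _ gx; have := Pnz _ _ fy; rewrite cE dE !scaler_eq0 !negb_or !outer_eq0.
rewrite !negb_or => /and3P[d0 py _] /and3P[c0 _ qg].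
rewrite -scalemxAl -scalemxAr mul_outer => /eqP.
rewrite !scaler_eq0 (negPf c0) (negPf d0) outer_eq0 (negPf py) (negPf qg) /= !orbF.
by move=> ->.
Qed.

End Types.

(** * The fundamental theorem of projective geometry *)

Lemma rmorphism_of_function (F : fieldType) (phi : F -> F) :
  phi 1 = 1 -> {morph phi : a b / a + b} -> {morph phi : a b / a * b} ->
  exists psi : {rmorphism F -> F}, psi =1 phi.
Proof.
move=> phi1 phiD phiM.
have phi0 : phi 0 = 0 by apply: (addrI (phi 0)); rewrite -phiD !addr0.
pose add := GRing.isNmodMorphism.Build F F phi (conj phi0 phiD).
pose mul := GRing.isMonoidMorphism.Build F F phi (conj phi1 phiM).
pose psi : {rmorphism F -> F} := HB.pack phi add mul.
by exists psi.
Qed.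

Section NormalizedProjectivity.
Variables (F : fieldType) (n : nat).
Variables (P : 'cV[F]_n.+3 -> 'cV[F]_n.+3) (Q : 'rV[F]_n.+3 -> 'rV[F]_n.+3).
Implicit Types (x : 'cV[F]_n.+3) (f : 'rV[F]_n.+3) (a b c : F).
Hypothesis QP : forall x f, x != 0 -> f != 0 ->
  (dot (Q f) (P x) == 0) = (dot f x == 0).
Hypothesis P_eq0 : forall x i, x != 0 -> (P x i 0 == 0) = (x i 0 == 0).
Hypothesis Q_eq0 : forall f i, f != 0 -> (Q f 0 i == 0) = (f 0 i == 0).
Hypothesis P_ones : forall i, P (const_mx 1) i 0 = 1.

(* The image under Q of the form x_i - c x_j is proportional to
   x_i - (ratio i j c) x_j. *)
Definition ratio i j c : F :=
  let f := delta_mx 0 i - c *: delta_mx 0 j in - Q f 0 j / Q f 0 i.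

(** By [Q_eq0] the image form is supported on [i] and [j], so incidence with it is a proportionality
    of two coordinates. *)
Lemma ratioP i j c x : i != j -> x != 0 ->
  (P x i 0 == ratio i j c * P x j 0) = (x i 0 == c * x j 0).
Proof.
move=> ij x0; rewrite /ratio; set f := delta_mx 0 i - _.
have fi : f 0 i = 1 by rewrite !mxE !eqxx (negPf ij) mulr0 subr0.
have f0 : f != 0 by apply/rV0Pn; exists i; rewrite fi oner_eq0.
have Qi : Q f 0 i != 0 by rewrite Q_eq0 // fi oner_eq0.
have fs s : s != i -> s != j -> f 0 s = 0.
  by move=> si sj; rewrite !mxE /= (negPf si) (negPf sj) mulr0 subr0.
have QPE : dot (Q f) (P x) = Q f 0 i * P x i 0 + Q f 0 j * P x j 0.
  rewrite dot_sum (bigD1 i) //= (bigD1 j) 1?eq_sym //= big1 ?addr0 // => s /andP[si sj].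
  by have /eqP -> : Q f 0 s == 0; [rewrite Q_eq0 // fs | rewrite mul0r].
have fx : dot f x = x i 0 - c * x j 0.
  by rewrite dotBl dotZl !dot_deltal.
rewrite -subr_eq0 -[in RHS]subr_eq0 -fx -QP // QPE subr_eq0.
rewrite -(inj_eq (mulfI Qi)) [X in _ == X]mulrA [Q f 0 i * (_ / _)]mulrC.
by rewrite divfK // mulNr -subr_eq0 opprK.
Qed.

Lemma ratio_eq i j c x : i != j -> x != 0 -> x i 0 = c * x j 0 ->
  P x i 0 = ratio i j c * P x j 0.
Proof. by move=> ij x0 /eqP; rewrite -ratioP // => /eqP. Qed.

Lemma ratio1 i j : i != j -> ratio i j 1 = 1.
Proof.
move=> ij; have x0 : const_mx 1 != 0 :> 'cV[F]_n.+3.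
  by apply/cV0Pn; exists i; rewrite mxE oner_eq0.
by have := @ratio_eq i j 1 _ ij x0; rewrite !mxE mul1r !P_ones mulr1 => /(_ erefl).
Qed.

(** The vector with entries [b * c], [c], [1] at [i], [j], [k] satisfies all three proportionalities
    at once. *)
Lemma ratioM i j k b c : i != j -> j != k -> i != k ->
  ratio i k (b * c) = ratio i j b * ratio j k c.
Proof.
move=> ij jk ik.
pose x : 'cV[F]_n.+3 := \col_s (if s == k then 1 else if s == j then c else b * c).
have xk : x k 0 = 1 by rewrite mxE eqxx.
have xj : x j 0 = c by rewrite mxE (negPf jk) eqxx.
have xi : x i 0 = b * c by rewrite mxE (negPf ik) (negPf ij).
have x0 : x != 0 by apply/cV0Pn; exists k; rewrite xk oner_eq0.
have Pk : P x k 0 != 0 by rewrite P_eq0 // xk oner_eq0.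
have Pik : P x i 0 = ratio i k (b * c) * P x k 0 by apply: ratio_eq; rewrite // xi xk mulr1.
have Pjk : P x j 0 = ratio j k c * P x k 0 by apply: ratio_eq; rewrite // xj xk mulr1.
have Pij : P x i 0 = ratio i j b * P x j 0 by apply: ratio_eq; rewrite // xi xj.
by apply: (mulIf Pk); rewrite -Pik -mulrA -Pjk.
Qed.

(** [ratioM] with one factor 1 changes one index at a time; if [i = j'], a detour through a third
    index avoids equal indices. *)
Lemma ratio_const i j i' j' c : i != j -> i' != j' -> ratio i j c = ratio i' j' c.
Proof.
have right i0 j0 k0 : i0 != j0 -> i0 != k0 -> ratio i0 j0 c = ratio i0 k0 c.
  move=> ij ik; have [->//|jk] := eqVneq j0 k0.
  by rewrite -[X in ratio i0 k0 X]mulr1 (@ratioM i0 j0 k0) // ratio1 // mulr1.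
have left i0 j0 k0 : i0 != k0 -> j0 != k0 -> ratio i0 k0 c = ratio j0 k0 c.
  move=> ik jk; have [->//|ij] := eqVneq i0 j0.
  by rewrite -[X in ratio i0 k0 X]mul1r (@ratioM i0 j0 k0) // ratio1 // mul1r.
move=> ij ij'; have [E|ne] := eqVneq i j'; last first.
  by rewrite (right i j j') // (left i i' j').
have [k ki ki'] := exists_third i i'; rewrite eq_sym in ki; rewrite eq_sym in ki'.
by rewrite (right i j k) // (left i i' k) // (right i' k j').
Qed.

Definition coord_mor : F -> F := ratio 0 ord_max.

Lemma ratio_coord_mor i j c : i != j -> ratio i j c = coord_mor c.
Proof. by move=> ij; apply: ratio_const. Qed.

Lemma coord_mor1 : coord_mor 1 = 1.
Proof. exact: ratio1. Qed.

Lemma coord_morM : {morph coord_mor : a b / a * b}.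
Proof.
move=> a b; have [l l0 lm] := exists_third (0 : 'I_n.+3) ord_max.
by rewrite [LHS](@ratioM 0 l) 1?[0 == l]eq_sym // !ratio_coord_mor // eq_sym.
Qed.

Lemma coord_mor0 : coord_mor 0 = 0.
Proof.
pose x : 'cV[F]_n.+3 := delta_mx ord_max 0.
have xm : x ord_max 0 = 1 by rewrite mxE !eqxx.
have x0 : x != 0 by apply/cV0Pn; exists ord_max; rewrite xm oner_eq0.
have xz : x 0 0 = 0 by rewrite mxE.
have Pm : P x ord_max 0 != 0 by rewrite P_eq0 // xm oner_eq0.
apply: (mulIf Pm); rewrite mul0r -ratio_eq // ?xz ?mul0r //.
by apply/eqP; rewrite P_eq0 // xz.
Qed.

Lemma P_coord_mor x i j : x != 0 -> x j 0 != 0 ->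
  P x i 0 = coord_mor (x i 0 / x j 0) * P x j 0.
Proof.
move=> x0 xj; have [->|ij] := eqVneq i j; first by rewrite divff // coord_mor1 mul1r.
by rewrite -(ratio_coord_mor _ ij) -ratio_eq // divfK.
Qed.

(** The form [x_i - x_j - x_l] kills each [v b c]. Testing on [v 1 0] and [v 0 1] shows that its
    image is proportional to itself, and [v 1 r] then gives the identity. *)
Lemma coord_morD1 r : coord_mor (1 + r) = 1 + coord_mor r.
Proof.
pose i : 'I_n.+3 := 0; pose j : 'I_n.+3 := ord_max.
have ij : i != j by [].
have [l li lj] := exists_third i j.
pose f : 'rV[F]_n.+3 := delta_mx 0 i - delta_mx 0 j - delta_mx 0 l.
have fi : f 0 i = 1.
  by rewrite !mxE !eqxx (negPf ij) [i == l]eq_sym (negPf li) !subr0.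
have f0 : f != 0 by apply/rV0Pn; exists i; rewrite fi oner_eq0.
have Qi : Q f 0 i != 0 by rewrite Q_eq0 // fi oner_eq0.
have QPE x : dot (Q f) (P x) = Q f 0 i * P x i 0 + Q f 0 j * P x j 0 + Q f 0 l * P x l 0.
  rewrite dot_sum (bigD1 i) //= (bigD1 j) 1?eq_sym //= (bigD1 l) ?li ?lj //=.
  rewrite big1 ?addr0 ?addrA // => s /andP[/andP[si sj] sl].
  suff /eqP -> : Q f 0 s == 0 by rewrite mul0r.
  by rewrite Q_eq0 // !mxE /= (negPf si) (negPf sj) (negPf sl) !subr0.
pose v b c : 'cV[F]_n.+3 :=
  \col_s (if s == i then b + c else if s == j then b else if s == l then c else 0).
have vi b c : v b c i 0 = b + c by rewrite mxE eqxx.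
have vj b c : v b c j 0 = b by rewrite mxE eqxx eq_sym (negPf ij).
have vl b c : v b c l 0 = c by rewrite mxE (negPf li) (negPf lj) eqxx.
have fv b c : dot f (v b c) = 0.
  rewrite !dotBl !dot_deltal vi vj vl.
  by rewrite addrAC addrK subrr.
have v10 b c : (b != 0) || (c != 0) -> v b c != 0.
  by case/orP=> nz; apply/cV0Pn; [exists j | exists l]; rewrite ?vj ?vl.
have v1 c : v 1 c != 0 by rewrite v10 ?oner_eq0.
have v2 : v 0 1 != 0 by rewrite v10 ?oner_eq0 ?orbT.
have E b c : v b c != 0 ->
    Q f 0 i * P (v b c) i 0 + Q f 0 j * P (v b c) j 0 + Q f 0 l * P (v b c) l 0 = 0.
  by move=> v0; apply/eqP; rewrite -QPE QP // fv.
have Qj : Q f 0 j = - Q f 0 i.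
  have /eqP := E 1 0 (v1 0); have /eqP -> : P (v 1 0) l 0 == 0 by rewrite P_eq0 // vl.
  rewrite (@P_coord_mor _ i j) ?vj ?oner_eq0 // vi addr0 divr1 coord_mor1 mul1r.
  rewrite mulr0 addr0 -mulrDl.
  by rewrite mulf_eq0 P_eq0 // vj oner_eq0 orbF addrC addr_eq0 => /eqP.
have Ql : Q f 0 l = - Q f 0 i.
  have /eqP := E 0 1 v2; have /eqP -> : P (v 0 1) j 0 == 0 by rewrite P_eq0 // vj.
  rewrite (@P_coord_mor _ i l) ?vl ?oner_eq0 // vi add0r divr1 coord_mor1 mul1r.
  rewrite mulr0 addr0 -mulrDl.
  by rewrite mulf_eq0 P_eq0 // vl oner_eq0 orbF addrC addr_eq0 => /eqP.
have := E 1 r (v1 r); rewrite Qj Ql !mulNr -!mulrBr => /eqP.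
rewrite mulf_eq0 (negPf Qi) /= (@P_coord_mor _ i j) ?vj ?oner_eq0 // vi divr1.
rewrite (@P_coord_mor _ l j) ?vj ?oner_eq0 // vl divr1 -{2}[P _ j 0]mul1r -!mulrBl.
rewrite mulf_eq0 P_eq0 // vj oner_eq0 orbF -addrA -opprD subr_eq0.
by move/eqP.
Qed.

Lemma coord_morD : {morph coord_mor : a b / a + b}.
Proof.
move=> a b; have [->|a0] := eqVneq a 0; first by rewrite coord_mor0 !add0r.
have -> : a + b = a * (1 + b / a) by rewrite mulrDr mulr1 mulrC divfK.
by rewrite coord_morM coord_morD1 mulrDr mulr1 -coord_morM mulrC divfK.
Qed.

End NormalizedProjectivity.

Section Semilinear.
Variable F : fieldType.

Lemma normalized_projectivity n (P : 'cV[F]_n.+3 -> 'cV[F]_n.+3)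
    (Q : 'rV[F]_n.+3 -> 'rV[F]_n.+3) :
  (forall x f, x != 0 -> f != 0 -> (dot (Q f) (P x) == 0) = (dot f x == 0)) ->
  (forall x i, x != 0 -> (P x i 0 == 0) = (x i 0 == 0)) ->
  (forall f i, f != 0 -> (Q f 0 i == 0) = (f 0 i == 0)) ->
  (forall i, P (const_mx 1) i 0 = 1) ->
  exists phi : {rmorphism F -> F},
    (forall x, x != 0 -> exists c, P x = c *: map_mx phi x) /\
    (forall f, f != 0 -> exists c, Q f = c *: map_mx phi f).
Proof.
move=> QP P0 Q0 P1.
have [phi phiE] := rmorphism_of_function (coord_mor1 QP Q0 P1)
  (coord_morD QP P0 Q0 P1) (coord_morM QP P0 Q0 P1).
have PE (x : 'cV_n.+3) j : x != 0 -> x j 0 != 0 ->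
    P x = (P x j 0 / phi (x j 0)) *: map_mx phi x.
  move=> x0 xj; apply/colP => i; rewrite !mxE.
  rewrite (P_coord_mor QP P0 Q0 P1 i x0 xj) -phiE fmorph_div.
  by rewrite mulrAC [RHS]mulrAC [X in X / _]mulrC.
exists phi; split=> [x x0|f f0].
  by have /cV0Pn[j xj] := x0; eexists; apply: PE x0 xj.
have /rV0Pn[j fj] := f0; exists (Q f 0 j / phi (f 0 j)); apply/rowP => i; rewrite !mxE.
have [->|ij] := eqVneq i j; first by rewrite divfK // fmorph_eq0.
(* A vector killed by [f] with support in [{i, j}]: incidence with its image compares two
   coordinates of [Q f]. *)
pose x : 'cV[F]_n.+3 := f 0 j *: delta_mx i 0 - f 0 i *: delta_mx j 0.
have xi : x i 0 = f 0 j by rewrite !mxE !eqxx (negPf ij) mulr1 mulr0 subr0.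
have x0 : x != 0 by apply/cV0Pn; exists i; rewrite xi.
have fx : dot f x = 0.
  by rewrite dotBr !dotZr !dot_deltar mulrC subrr.
have : dot (Q f) (map_mx phi x) == 0.
  have xi0 : x i 0 != 0 by rewrite xi.
  have := QP x f x0 f0; rewrite (PE x i x0 xi0) fx eqxx dotZr mulf_eq0.
  by rewrite mulf_eq0 invr_eq0 fmorph_eq0 P0 // (negPf xi0).
rewrite map_mxB !map_mxZ !map_delta_mx dotBr !dotZr !dot_deltar subr_eq0 => /eqP E.
apply: (mulfI (x := phi (f 0 j))); first by rewrite fmorph_eq0.
by rewrite E mulrCA [in RHS]mulrA divfK ?fmorph_eq0 // mulrC.
Qed.

Lemma projectivity_semilinear n (p : 'cV[F]_n.+3 -> 'cV[F]_n.+3)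
    (q : 'rV[F]_n.+3 -> 'rV[F]_n.+3) :
  (forall x f, x != 0 -> f != 0 -> (dot (q f) (p x) == 0) = (dot f x == 0)) ->
  exists (phi : {rmorphism F -> F}) (T : 'M[F]_n.+3),
    [/\ T \in unitmx, forall x, x != 0 -> exists c, p x = c *: (T *m map_mx phi x) &
        forall f, f != 0 -> exists c, q f = c *: (map_mx phi f *m invmx T)].
Proof.
move=> qp; pose e (i : 'I_n.+3) : 'cV[F]_n.+3 := delta_mx i 0.
pose e' (i : 'I_n.+3) : 'rV[F]_n.+3 := delta_mx 0 i.
have e0 i : e i != 0 by apply/cV0Pn; exists i; rewrite mxE !eqxx oner_eq0.
have e'0 i : e' i != 0 by apply/rV0Pn; exists i; rewrite mxE !eqxx oner_eq0.
have ones0 : const_mx 1 != 0 :> 'cV[F]_n.+3.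
  by apply/cV0Pn; exists 0; rewrite mxE oner_eq0.
pose d i := dot (q (e' i)) (p (const_mx 1)).
have d0 i : d i != 0 by rewrite /d qp // dot_deltal mxE oner_eq0.
(* The rows are the forms [q (e' i)], scaled so that [S] sends the image of the all-ones vector to
   the all-ones vector. *)
pose S : 'M_n.+3 := \matrix_(i, a) ((d i)^-1 * q (e' i) 0 a).
have SE x i : (S *m x) i 0 = (d i)^-1 * dot (q (e' i)) x.
  rewrite mxE dot_sum mulr_sumr; apply: eq_bigr => a _.
  by rewrite mxE mulrA.
have Su : S \in unitmx.
  pose t i := dot (q (e' i)) (p (e i)).
  suff YS : \matrix_(a, i) ((t i)^-1 * p (e i) a 0 * d i) *m S = 1%:M.
    by have [_] := mulmx1_unit YS.
  have <- : \sum_i (t i)^-1 *: (p (e i) *m q (e' i)) = 1%:M.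
    apply: biorthogonal_resolution => [i j ij|i].
      by apply/eqP; rewrite qp // dot_deltal mxE (negPf ij).
    by rewrite qp // dot_deltal mxE !eqxx oner_eq0.
  apply/matrixP=> a b; rewrite summxE mxE; apply: eq_bigr => i _.
  by rewrite !mxE big_ord1 mulrA mulfK // mulrA.
pose P x := S *m p x; pose Q f := q f *m invmx S.
have QP x f : x != 0 -> f != 0 -> (dot (Q f) (P x) == 0) = (dot f x == 0).
  by move=> x0 f0; rewrite dot_mulmx mulKmx // qp.
have P0 x i : x != 0 -> (P x i 0 == 0) = (x i 0 == 0).
  by move=> x0; rewrite SE mulf_eq0 invr_eq0 (negPf (d0 i)) qp // dot_deltal.
have Q0 f i : f != 0 -> (Q f 0 i == 0) = (f 0 i == 0).
  (* By [P0] the vector [P (e i)] is a multiple of [e i], so coordinate [i] of [Q f] vanishes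
     exactly when [f] kills [e i]. *)
  move=> f0; have Pe : P (e i) = P (e i) i 0 *: e i.
    apply/colP => s; rewrite [RHS]mxE [e i s 0]mxE.
    case: eqVneq => [->|si]; first by rewrite mulr1.
    by rewrite mulr0; apply/eqP; rewrite P0 // mxE (negPf si).
  have := QP (e i) f (e0 i) f0; rewrite Pe dotZr !dot_deltar mulf_eq0 P0 //.
  by rewrite mxE !eqxx oner_eq0.
have P1 i : P (const_mx 1) i 0 = 1 by rewrite SE mulVf.
have [phi [PE QE]] := normalized_projectivity QP P0 Q0 P1.
exists phi, (invmx S); split=> [|x /PE[c cE]|f /QE[c cE]].
- by rewrite unitmx_inv.
- by exists c; rewrite scalemxAr -cE mulKmx.
- by exists c; rewrite invmxK scalemxAl -cE mulmxKV.
Qed.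

(** Since [phi] may be nonsurjective, only images of vectors in the kernel of [f] are available; the
    vectors [f_j e_i - f_i e_j] suffice. *)
Lemma semilinear_kernel m n (phi : {rmorphism F -> F}) (f : 'rV[F]_n) (B : 'M[F]_(m, n)) :
  f != 0 -> (forall x, dot f x = 0 -> B *m map_mx phi x = 0) ->
  exists w : 'cV_m, B = w *m map_mx phi f.
Proof.
move=> /rV0Pn[j fj] B0; exists ((phi (f 0 j))^-1 *: col j B).
apply/matrixP => s i; rewrite [RHS]mxE big_ord1 !mxE.
apply: (mulfI (x := phi (f 0 j))); first by rewrite fmorph_eq0.
rewrite !mulrA mulfV ?fmorph_eq0 // mul1r.
have fx : dot f (f 0 j *: delta_mx i 0 - f 0 i *: delta_mx j 0) = 0.
  by rewrite dotBr !dotZr !dot_deltar mulrC subrr.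
have /matrixP/(_ s 0) := B0 _ fx.
rewrite map_mxB !map_mxZ !map_delta_mx mulmxBr -!scalemxAr -!colE !mxE => /eqP.
by rewrite subr_eq0 => /eqP->; rewrite mulrC.
Qed.

(** The forms killing [x] have dimension at least 2, so some lie outside the span of [f]; a nonzero
    entry of [kermx x *m cokermx f] pairs such a form with a vector killed by [f]. *)
Lemma exists_traced_orth n (x : 'cV[F]_n.+3) (f : 'rV[F]_n.+3) :
  exists y g, [/\ dot f y = 0, dot g x = 0 & dot g y != 0].
Proof.
have : ~~ (kermx x <= f)%MS.
  apply/negP => /mxrankS; rewrite mxrank_ker leqNgt => /negP; apply.
  apply: (leq_ltn_trans (rank_leq_row f)).
  by rewrite ltn_subRL (leq_ltn_trans (leq_add (rank_leq_col x) (leqnn 1))).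
rewrite submxE => /matrix0Pn[a [b ab]].
exists (col b (cokermx f)), (row a (kermx x)); split.
- by rewrite /dot colE mulmxA mulmx_coker mul0mx mxE.
- by rewrite /dot rowE -mulmxA mulmx_ker mulmx0 mxE.
- by rewrite /dot colE mulmxA -row_mul -colE mxE [X in X != 0]mxE.
Qed.

End Semilinear.

(** * The form of the map on all rank-one matrices *)

Section Form.
Variables (F : closedFieldType) (n : nat).
Implicit Types (Phi : 'M[F]_n.+3 -> 'M[F]_n.+3) (A : 'M[F]_n.+3).
Implicit Types (x y : 'cV[F]_n.+3) (f g : 'rV[F]_n.+3).

Lemma orth_preserving_col_form Phi : orth_preserving Phi ->
  (forall x, vector_col Phi x) -> (forall f, form_col (tr_after Phi) f) ->
  exists (phi : {rmorphism F -> F}) (T : 'M[F]_n.+3),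
    T \in unitmx /\ forall A, \rank A = 1%N ->
      exists2 c, c != 0 & Phi A = c *: (T *m map_mx phi A *m invmx T).
Proof.
move=> oP cV rf; have [P1 P2] := oP.
have [p [q [PE qp]]] := projectivities oP cV rf.
have [phi [T [Tu pE qE]]] := projectivity_semilinear qp.
exists phi, T; split=> //.
(* The zero matrix is orthogonal to everything, whereas [x *m f] is not orthogonal to [y *m g] when
   [f] and [g] are nonzero at [y]. *)
have Pnz A : \rank A = 1%N -> Phi A != 0.
  move=> rA; apply/eqP => PA0; have [x [f [x0 f0 AE]]] := rank1_outer rA.
  have [y fy] := exists_dotl f0.
  have [g [gy]] : exists g, dot g y != 0.
    by apply: exists_dotr; apply: contraNneq fy => ->; rewrite dot0r.
  have B1 := rank1_traced_outer gy.
  have [_ /eqP] : orth (y *m g) A by apply/P2 => //; rewrite /orth PA0 mulmx0 mul0mx.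
  rewrite AE mul_outer scaler_eq0 (negPf fy) outer_eq0 (negPf x0) /=.
  by move/eqP=> g0; rewrite g0 dot0l eqxx in gy.
have traced x f : dot f x != 0 -> exists2 c, c != 0 &
    Phi (x *m f) = c *: ((T *m map_mx phi x) *m (map_mx phi f *m invmx T)).
  move=> fx; have x0 : x != 0 by apply: contraNneq fx => ->; rewrite dot0r.
  have f0 : f != 0 by apply: contraNneq fx => ->; rewrite dot0l.
  have [c cE] := PE x f fx; have [a aE] := pE x x0; have [b bE] := qE f f0.
  have E : Phi (x *m f) = (c * (a * b)) *:
      ((T *m map_mx phi x) *m (map_mx phi f *m invmx T)).
    by rewrite cE aE bE -!scalerA; congr (_ *: _); rewrite -scalemxAl -scalemxAr.
  exists (c * (a * b)) => //; apply: contraNneq (Pnz _ (rank_outer x0 f0)) => c0.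
  by rewrite E c0 scale0r.
suff form x f : x != 0 -> f != 0 -> exists c,
    Phi (x *m f) = c *: (T *m map_mx phi (x *m f) *m invmx T).
  move=> A rA; have [x [f [x0 f0 AE]]] := rank1_outer rA.
  have [c cE] := form x f x0 f0; rewrite AE; exists c => //.
  by apply: contraNneq (Pnz A rA) => c0; rewrite AE cE c0 scale0r.
move=> x0 f0.
have [fx|fx] := eqVneq (dot f x) 0; last first.
  by have [c _ ->] := traced x f fx; exists c; rewrite map_mxM !mulmxA.
(* In the nilpotent case, [B] is shown to be a multiple of [map_mx phi (x *m f)] by finding enough
   vectors and forms that annihilate it. *)
pose B := invmx T *m Phi (x *m f) *m T.
have ortho y g : dot g y != 0 -> dot f y = 0 -> dot g x = 0 ->
    B *m map_mx phi y = 0 /\ map_mx phi g *m B = 0.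
  move=> gy fy gx; have [c c0 cE] := traced y g gy.
  have y0 : y != 0 by apply: contraNneq gy => ->; rewrite dot0r.
  have g0 : g != 0 by apply: contraNneq gy => ->; rewrite dot0l.
  have [] : orth (Phi (y *m g)) (Phi (x *m f)).
    apply: (proj1 (P2 _ _ (rank1_traced_outer gy) (rank_outer x0 f0))).
    exact: orth_outer.
  rewrite cE -scalemxAl -scalemxAr => /eqP + /eqP.
  rewrite !scaler_eq0 (negPf c0) /=.
  rewrite -[_ *m _ *m Phi _]mulmxA [Phi _ *m _]mulmxA !outer_eq0.
  have -> : (T *m map_mx phi y == 0) = false.
    apply: contraNF y0 => /eqP Ty.
    by rewrite -(map_mx_eq0 phi) -[map_mx phi y](mulKmx Tu) Ty mulmx0.
  have -> : (map_mx phi g *m invmx T == 0) = false.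
    apply: contraNF g0 => /eqP gT.
    by rewrite -(map_mx_eq0 phi) -[map_mx phi g](mulmxKV Tu) gT mul0mx.
  rewrite orbF /= => /eqP gB /eqP By; split.
    by rewrite /B -!mulmxA By mulmx0.
  by rewrite /B !mulmxA gB mul0mx.
have [y1 [g1 [fy1 gx1 gy1]]] := exists_traced_orth x f.
have [w wE] : exists w, B = w *m map_mx phi f.
  apply: semilinear_kernel f0 _ => y fy.
  have [|] := classic (exists2 g, dot g x = 0 & dot g y != 0).
    by case=> g gx gy; case: (ortho y g gy fy gx).
  (* No form killing [x] detects [y], but [g1] detects both [y1] and [y + y1]; [B] kills the images
     of both, hence that of [y]. *)
  move=> ng; have g1y : dot g1 y = 0.
    by apply/eqP/negPn/negP => g1y; apply: ng; exists g1.
  have [|//|//|By _] := ortho (y + y1) g1; first by rewrite dotDr g1y add0r.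
    by rewrite dotDr fy fy1 addr0.
  have [By1 _] := ortho _ _ gy1 fy1 gx1.
  by move: By; rewrite map_mxD mulmxDr By1 addr0.
have [v vE] : exists v, B^T = v *m map_mx phi x^T.
  apply: semilinear_kernel; first by rewrite trmx_eq0.
  move=> g'; rewrite -{1}(trmxK g') dot_tr; move: g'^T (trmxK g') => g <- gx.
  apply/trmx_inj; rewrite trmx_mul trmxK map_trmx trmxK trmx0.
  have [|] := classic (exists2 y, dot f y = 0 & dot g y != 0).
    by case=> y fy gy; case: (ortho y g gy fy gx).
  move=> ng; have gy1' : dot g y1 = 0.
    by apply/eqP/negPn/negP => gy; apply: ng; exists y1.
  have [|//||_ gB] := ortho y1 (g + g1); first by rewrite dotDl gy1' add0r.
    by rewrite dotDl gx gx1 addr0.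
  have [_ g1B] := ortho _ _ gy1 fy1 gx1.
  by move: gB; rewrite map_mxD mulmxDl g1B addr0.
have /rV0Pn[j fj] := f0.
(* Comparing column [j] of the two factorizations of [B] makes [w] proportional to
   [map_mx phi x]. *)
have BE : B = (v j 0 / phi (f 0 j)) *: (map_mx phi x *m map_mx phi f).
  have wj : phi (f 0 j) *: w = v j 0 *: map_mx phi x.
    have := congr1 (col j) wE; rewrite -{1}[B]trmxK vE trmx_mul map_trmx trmxK.
    move=> E; apply/colP => i; move/colP: E => /(_ i).
    by rewrite !mxE !big_ord1 !mxE => Ei; rewrite mulrC -Ei mulrC.
  rewrite wE; have -> : w = (v j 0 / phi (f 0 j)) *: map_mx phi x.
    by rewrite mulrC -scalerA -wj scalerA mulVf ?fmorph_eq0 // scale1r.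
  by rewrite scalemxAl.
exists (v j 0 / phi (f 0 j)).
rewrite map_mxM scalemxAl scalemxAr -BE /B !mulmxA mulmxV // mul1mx.
by rewrite mulmxK.
Qed.

Lemma orth_preserving_form Phi : orth_preserving Phi ->
  exists (phi : {rmorphism F -> F}) (T : 'M[F]_n.+3),
    T \in unitmx /\
    ((forall A, \rank A = 1%N ->
       exists2 c, c != 0 & Phi A = c *: (T *m map_mx phi A *m invmx T)) \/
     (forall A, \rank A = 1%N ->
       exists2 c, c != 0 & Phi A = c *: (T *m (map_mx phi A)^T *m invmx T))).
Proof.
move=> oP; have oPa := orth_preserving_tr_after oP.
pose x : 'cV[F]_n.+3 := const_mx 1.
have x0 : x != 0 by apply/cV0Pn; exists 0; rewrite mxE oner_eq0.
have [cx|rx] := vector_type x oP.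
  have [cV rf] := global_type oP x0 cx.
  have [phi [T [Tu E]]] := orth_preserving_col_form oP cV rf.
  by exists phi, T; split=> //; left.
have [cV rf] := global_type oPa x0 rx.
have [phi [T [Tu E]]] := orth_preserving_col_form oPa cV rf.
(* Transposing a conjugate by [T] gives the transpose conjugated by the inverse transpose of [T]. *)
exists phi, (invmx T^T); rewrite unitmx_inv unitmx_tr; split=> //; right=> A rA.
have [c c0 /(congr1 trmx)] := E A rA; rewrite trmxK => ->; exists c => //.
by rewrite linearZ /= !trmx_mul trmx_inv invmxK mulmxA.
Qed.

End Form.

Theorem corollary2p5 (F : closedFieldType) (n k : nat)
    (hn : (3 <= n)%N) (hk : (2 <= k)%N)
    (alpha : 'S_k -> F)
    (halpha : \sum_(s : 'S_k) alpha s != 0)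
    (hCof : Cof alpha \in unitmx)
    (D1 D2 : 'M[F]_n -> Prop)
    (hD1r : contains_rank_one D1)
    (hD1i : contains_corank_one_idempotents D1)
    (hD2r : contains_rank_one D2)
    (hD2i : contains_corank_one_idempotents D2)
    (Phi : 'M[F]_n -> 'M[F]_n)
    (hPhi : maps_into D1 D2 Phi)
    (hzero : strongly_preserves_zeros alpha D1 Phi) :
  exists (phi : {rmorphism F -> F}) (gamma : 'M[F]_n -> F) (T : 'M[F]_n),
    [/\ T \in unitmx,
        forall A : 'M[F]_n, D1 A -> A != 0 -> gamma A != 0 &
        (forall A : 'M[F]_n, \rank A = 1%N ->
           Phi A = gamma A *: (T *m map_mx phi A *m invmx T))
        \/
        (forall A : 'M[F]_n, \rank A = 1%N ->
           Phi A = gamma A *: (T *m (map_mx phi A)^T *m invmx T))].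
Proof.
case: n hn D1 D2 hD1r {hD1i hD2r hD2i} Phi {hPhi} hzero => [|[|[|n]]] // _.
move=> D1 _ D1r Phi hzero.
case: k hk alpha {halpha} hCof hzero => [|[|k]] // _ alpha hCof hzero.
have sPhi A B : \rank A = 1%N -> \rank B = 1%N ->
    sandwich k.+2 A B <-> sandwich k.+2 (Phi A) (Phi B).
  move=> rA rB; rewrite !(sandwich_mlpoly _ _ hCof).
  have E j : mlpoly_eval alpha (fun i => Phi (if i == j then B else A)) =
      mlpoly_eval alpha (fun i => if i == j then Phi B else Phi A).
    by apply: eq_bigr => s _; congr (_ *: _); apply: eq_bigr => i _; case: ifP.
  have hD (j i : 'I_k.+2) : D1 (if i == j then B else A) by case: ifP => _; apply: D1r.
  split=> H j; first by rewrite -E; apply: (proj1 (hzero _ (hD j)) (H j)).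
  by apply: (proj2 (hzero _ (hD j))); rewrite E.
have [phi [T [Tu]]] := orth_preserving_form (orth_preserving_of_sandwich sPhi).
have gammaE (R : 'M[F]_n.+3 -> 'M[F]_n.+3) :
    (forall A, \rank A = 1%N -> exists2 c, c != 0 & Phi A = c *: R A) ->
    exists gamma : 'M[F]_n.+3 -> F, (forall A, gamma A != 0) /\
      forall A, \rank A = 1%N -> Phi A = gamma A *: R A.
  move=> H; have /functional_choice[gamma gammaP] : forall A, exists c,
      c != 0 /\ (\rank A = 1%N -> Phi A = c *: R A).
    move=> A; have [/H[c c0 cE]|rA] := eqVneq (\rank A) 1%N; first by exists c.
    (* Off rank one [gamma] takes the default value 1, so it vanishes nowhere. *)
    by exists 1; rewrite oner_eq0; split=> // /eqP; rewrite (negPf rA).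
  by exists gamma; split=> A; case: (gammaP A).
case=> /gammaE[gamma [gamma0 gammaP]]; exists phi, gamma, T; split=> //.
- by left.
- by right.
Qed.
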